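(* Let $((F,\nu,N),[\cdot,\cdot]_{F,h},(\rho,\eta))$ be a generalized Lie algebroid, let $L$ be a Lagrange fundamental function on the vector bundle $(E,\pi,M)$ and let $H$ be its Legendre transformation. If the vector bundle morphism $((\rho,\eta)T\varphi_L,\varphi_L)$ from $(\rho,\eta)TE$ to $(\rho,\eta)TE^*$ is a morphism of Lie algebroids, then, for all values of the free indices: $$(L^\gamma_{\alpha\beta}\circ h\circ\pi)\circ\varphi_H=L^\gamma_{\alpha\beta}\circ h\circ\overset{*}{\pi},$$ $$\begin{aligned}\big(((L^\gamma_{\alpha\beta}\rho^k_\gamma)\circ h\circ\pi)\,L_{kb}\big)\circ\varphi_H={}&(\rho^i_\alpha\circ h\circ\overset{*}{\pi})\tfrac{\partial}{\partial x^i}\big(((\rho^j_\beta\circ h\circ\pi)L_{jb})\circ\varphi_H\big)-(\rho^j_\beta\circ h\circ\overset{*}{\pi})\tfrac{\partial}{\partial x^j}\big(((\rho^i_\alpha\circ h\circ\pi)L_{ib})\circ\varphi_H\big)\\&+\big(((\rho^i_\alpha\circ h\circ\pi)L_{ia})\circ\varphi_H\big)\tfrac{\partial}{\partial p_a}\big(((\rho^j_\beta\circ h\circ\pi)L_{jb})\circ\varphi_H\big)\\&-\big(((\rho^j_\beta\circ h\circ\pi)L_{ja})\circ\varphi_H\big)\tfrac{\partial}{\partial p_a}\big(((\rho^i_\alpha\circ h\circ\pi)L_{ib})\circ\varphi_H\big),\end{aligned}$$ $$\begin{aligned}0={}&(\rho^i_\alpha\circ h\circ\overset{*}{\pi})\tfrac{\partial}{\partial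 x^i}(L_{ba}\circ\varphi_H)+\big(((\rho^i_\alpha\circ h\circ\pi)L_{ic})\circ\varphi_H\big)\tfrac{\partial}{\partial p_c}(L_{ba}\circ\varphi_H)\\&-(L_{bc}\circ\varphi_H)\tfrac{\partial}{\partial p_c}\big(((\rho^i_\alpha\circ h\circ\pi)L_{ia})\circ\varphi_H\big),\end{aligned}$$ $$0=(L_{ac}\circ\varphi_H)\tfrac{\partial}{\partial p_c}(L_{bd}\circ\varphi_H)-(L_{bc}\circ\varphi_H)\tfrac{\partial}{\partial p_c}(L_{ad}\circ\varphi_H).$$
   Context: Repeated indices are summed. $M,N$ are $m$-dimensional manifolds, $h:M\to N$, $\eta:N\to M$ diffeomorphisms; a generalized Lie algebroid consists of a vector bundle $(F,\nu,N)$, a vector bundle morphism $(\rho,\eta)$ from $(F,\nu,N)$ to $(TM,\tau_M,M)$ with local components $\rho^i_\alpha$ (functions on $N$), and a Lie bracket on $\Gamma(F,\nu,N)$ satisfying $[z,fw]_{F,h}=f[z,w]_{F,h}+(\Gamma(Th\circ\rho,h\circ\eta)(z)f)w$, where $\Gamma(Th\circ\rho,h\circ\eta)(z^\alpha t_\alpha)(f)=z^\alpha\rho_\alpha^i\big(\tfrac{\partial(f\circ h)}{\partial x^i}\circ h^{-1}\big)$, $(t_\alpha)$ a local frame of $F$, and $[t_\alpha,t_\beta]_{F,h}=L^\gamma_{\alpha\beta}t_\gamma$. $(E,\pi,M)$ has rank $r$, local frame $(s_a)$, coordinates $(x^i,y^a)$, vector fields $\partial_i,\dot\partial_a$; its dual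 $(E^*,\overset{*}{\pi},M)$ has dual frame $(s^a)$, coordinates $(x^i,p_a)$, vector fields $\overset{*}{\partial}_i=\partial/\partial x^i$, $\dot\partial^a=\partial/\partial p_a$. $(\rho,\eta)TE\subset(h\circ\pi)^*F\oplus TE$ is the vector bundle over $E$ with local frame $\tilde\partial_\alpha=T_\alpha\oplus(\rho^i_\alpha\circ h\circ\pi)\partial_i$, $\dot{\tilde\partial}_a=0\oplus\dot\partial_a$ ($T_\alpha$ induced by $t_\alpha$). It is a Lie algebroid with anchor $X^\alpha\tilde\partial_\alpha+\tilde X^a\dot{\tilde\partial}_a\mapsto X^\alpha(\rho_\alpha^i\circ h\circ\pi)\partial_i+\tilde X^a\dot\partial_a$ and bracket determined by $[\tilde\partial_\alpha,\tilde\partial_\beta]=(L^\gamma_{\alpha\beta}\circ h\circ\pi)\tilde\partial_\gamma$, $[\tilde\partial_\alpha,\dot{\tilde\partial}_b]=0=[\dot{\tilde\partial}_a,\dot{\tilde\partial}_b]$ and the Leibniz rule. Likewise $(\rho,\eta)TE^*\subset(h\circ\overset{*}{\pi})^*F\oplus TE^*$ has frame $\overset{*}{\tilde\partial}_\alpha=\overset{*}{T}_\alpha\oplus(\rho^i_\alpha\circ h\circ\overset{*}{\pi})\overset{*}{\partial}_i$, $\dot{\tilde\partial}{}^a=0\oplus\dot\partial^a$, anchor $X^\alpha\overset{*}{\tilde\partial}_\alpha+\tilde X_a\dot{\tilde\partial}{}^a\mapsto X^\alpha(\rho_\alpha^i\circ h\circ\overset{*}{\pi})\overset{*}{\partial}_i+\tilde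 X_a\dot\partial^a$, and brackets $[\overset{*}{\tilde\partial}_\alpha,\overset{*}{\tilde\partial}_\beta]=(L^\gamma_{\alpha\beta}\circ h\circ\overset{*}{\pi})\overset{*}{\tilde\partial}_\gamma$, all other brackets of frame elements zero. A Lagrange fundamental function is $L:E\to\mathbb R$ with $L\circ u\in C^\infty(M)$ for every nonzero section $u$ and $L\circ0\in C^0(M)$; the derivatives $L_{ab}=\partial^2L/\partial y^a\partial y^b$, $L_{ib}=\partial^2L/\partial x^i\partial y^b$ are taken to exist (and be smooth off the zero section). Legendre morphism $\varphi_L:E\to E^*$, $u^as_a(x)\mapsto u^aL_{ab}(u_x)s^b(x)$. The Legendre transformation of $L$ is the Hamilton fundamental function $H$ on $E^*$ (same regularity conditions) given locally by $H(\overset{*}{u}_x)=u_au^a-L(u_x)$ for $\overset{*}{u}_x=u_as^a(x)$, where $u_x=u^as_a(x)$ solves $u_b=u^aL_{ab}(u_x)$, $b=1,\dots,r$. $\varphi_H:E^*\to E$, $u_as^a(x)\mapsto u_aH^{ab}(\overset{*}{u}_x)s_b(x)$, $H^{ab}=\partial^2H/\partial p_a\partial p_b$. The morphism $((\rho,\eta)T\varphi_L,\varphi_L)$ acts on sections additively by $$\Gamma((\rho,\eta)T\varphi_L,\varphi_L)(Z^\alpha\tilde\partial_\alpha)=(Z^\alpha\circ\varphi_H)\overset{*}{\tilde\partial}_\alpha+\big([(\rho^i_\alpha\circ h\circ\pi)Z^\alpha L_{ib}]\circ\varphi_H\big)\dot{\tilde\partial}{}^b,$$ $$\Gamma((\rho,\eta)T\varphi_L,\varphi_L)(Y^a\dot{\tilde\partial}_a)=\big((Y^aL_{ab})\circ\varphi_H\big)\dot{\tilde\partial}{}^b.$$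 It is a morphism of Lie algebroids when this map on sections preserves brackets. All identities are understood where the functions involved are defined. *)

(* Defs.v *)
From HB Require Import structures.
From mathcomp Require Import all_boot all_order all_algebra.
From mathcomp Require Import all_classical all_reals all_analysis.
From mathcomp Require Import ring.

Set Implicit Arguments.
Unset Strict Implicit.
Unset Printing Implicit Defensive.

Import Order.TTheory GRing.Theory Num.Theory.
Import numFieldNormedType.Exports.
Local Open Scope classical_set_scope.
Local Open Scope ring_scope.

(** * Smooth maps between (finite-dimensional) normed spaces *)

Section Smooth.
Context {R : realType} {V W : normedModType R}.

(* [U] is meant to be open; in finite dimension this is the usual [C^k]. *)
Fixpoint Ck (k : nat) (U : set V) (f : V -> W) : Prop :=
  (forall x, U x -> {for x, continuous f}) /\
  if k is k'.+1 then
    forall v, (forall x, U x -> derivable f x v) /\ Ck k' U ('D_v f)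
  else True.

Definition smooth_on (U : set V) (f : V -> W) : Prop := forall k, Ck k U f.

Let eq_cont (U : set V) (f g : V -> W) : open U ->
  (forall x, U x -> f x = g x) -> (forall x, U x -> {for x, continuous f}) ->
  forall x, U x -> {for x, continuous g}.
Proof.
move=> oU fg cf x Ux; have := cf x Ux; rewrite /prop_for /continuous_at fg//.
apply: cvg_trans; apply: near_eq_cvg.
by apply: filterS (open_nbhs_nbhs (conj oU Ux)) => y /fg.
Qed.

Lemma eq_Ck k (U : set V) (f g : V -> W) :
  open U -> (forall x, U x -> f x = g x) -> Ck k U f -> Ck k U g.
Proof.
move=> oU; elim: k f g => [|k IH] f g fg.
  by case=> cf _; split => // x Ux; exact: eq_cont oU fg cf x Ux.
case=> cf df; split; first by move=> x Ux; exact: eq_cont oU fg cf x Ux.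
move=> v; have [dfv Cfv] := df v.
have nfg x : U x -> \forall y \near x, f y = g y.
  by move=> Ux; apply: filterS (open_nbhs_nbhs (conj oU Ux)) => y /fg.
split; first by move=> x Ux; apply: near_eq_derivable (nfg x Ux) (dfv x Ux).
by apply: IH Cfv => x Ux; exact: near_eq_derive (nfg x Ux).
Qed.

End Smooth.

(** * Smooth manifolds *)

Record chart (R : realType) (m : nat) (T : topologicalType) := Chart {
  cdom : set T ;
  cmap : T -> 'rV[R]_m ;
  cinv : 'rV[R]_m -> T ;
  cdom_open : open cdom ;
  cimg_open : open (cmap @` cdom) ;
  cmapK : forall x, cdom x -> cinv (cmap x) = x ;
  cmap_cont : forall x, cdom x -> {for x, continuous cmap} ;
  cinv_cont : forall v, (cmap @` cdom) v -> {for v, continuous cinv} }.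

(* The atlas need not be maximal. *)
Record manifold (R : realType) (m : nat) := Manifold {
  mspace :> topologicalType ;
  atlas : set (chart R m mspace) ;
  mhausdorff : hausdorff_space mspace ;
  msecond_countable : @second_countable mspace ;
  atlas_cover : forall x : mspace, exists2 c, atlas c & cdom c x ;
  atlas_compat : forall c d, atlas c -> atlas d ->
    smooth_on (cmap c @` (cdom c `&` cdom d)) (cmap d \o cinv c) }.

Section Manifolds.
Context {R : realType} {m : nat}.
Implicit Types M N : manifold R m.

Definition smooth_fun M (U : set M) (f : M -> R) : Prop :=
  forall c, atlas c -> smooth_on (cmap c @` (cdom c `&` U)) (f \o cinv c).

Definition smooth_map M N (g : M -> N) : Prop :=
  continuous g /\
  forall c d, atlas c -> atlas d ->
    smooth_on (cmap c @` (cdom c `&` g @^-1` cdom d)) (cmap d \o g \o cinv c).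

Record diffeo M N := Diffeo {
  dfun :> M -> N ;
  dinv : N -> M ;
  dfunK : cancel dfun dinv ;
  dinvK : cancel dinv dfun ;
  dfun_smooth : smooth_map dfun ;
  dinv_smooth : smooth_map dinv }.

(* A tangent vector is the family of its components in the charts around the
   base point; [tcompE] is the change of components by the Jacobian matrix. *)
Record tangent M (x : M) := Tangent {
  tcomp : chart R m M -> 'rV[R]_m ;
  tcompE : forall c d, atlas c -> atlas d -> cdom c x -> cdom d x ->
    tcomp d = 'D_(tcomp c) (cmap d \o cinv c) (cmap c x) }.

Lemma cmap_img_open (T : topologicalType) (c : chart R m T) (U : set T) :
  open U -> open (cmap c @` (cdom c `&` U)).
Proof.
move=> oU; rewrite openE => _ [x [cx Ux] <-].
have cv : (cmap c @` cdom c) (cmap c x) by exists x.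
have nU : nbhs (cinv c (cmap c x)) U by rewrite cmapK//; exact: open_nbhs_nbhs.
have n1 : nbhs (cmap c x) (cmap c @` cdom c).
  by apply: open_nbhs_nbhs; split=> //; exact: cimg_open.
have n2 : nbhs (cmap c x) (cinv c @^-1` U) by exact: (cinv_cont cv nU).
apply: filterS (filterI n1 n2) => _ [[y cy <-]]; rewrite /= cmapK// => Uy.
by exists y.
Qed.

End Manifolds.

(** * Smooth vector bundles *)

Record lframe (R : realType) (T : topologicalType) (B : T -> vectType R)
    (r : nat) := LFrame {
  fdom : set T ;
  fvec : forall x : T, r.-tuple (B x) ;
  fdom_open : open fdom ;
  fvec_basis : forall x, fdom x -> basis_of fullv (fvec x) }.

(* A bundle is given by its fibres and a family of local frames (local
   trivializations), not necessarily maximal, with smooth transitions. *)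
Record vbundle (R : realType) (m : nat) (M : manifold R m) (r : nat) :=
  VBundle {
  fibre :> M -> vectType R ;
  frames : set (lframe fibre r) ;
  frames_cover : forall x : M, exists2 s, frames s & fdom s x ;
  frames_compat : forall s s', frames s -> frames s' -> forall a b : 'I_r,
    smooth_fun (fdom s `&` fdom s')
      (fun x => coord (fvec s' x) b (fvec s x)`_a) }.

Definition section (R : realType) (m : nat) (M : manifold R m) (r : nat)
  (E : vbundle M r) := forall x : M, E x.

Definition smooth_section (R : realType) (m : nat) (M : manifold R m)
    (r : nat) (E : vbundle M r) (z : section E) : Prop :=
  forall s, frames s -> forall a : 'I_r,
    smooth_fun (fdom s) (fun x => coord (fvec s x) a (z x)).

Section Dual.
Context {R : realType}.

Definition dual_fibre (T : topologicalType) (B : T -> vectType R) (x : T) :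
  vectType R := 'Hom(B x, R^o).

Definition dual_vec (T : topologicalType) (B : T -> vectType R) (r : nat)
    (s : lframe B r) (x : T) : r.-tuple (dual_fibre B x) :=
  [tuple linfun (coord (fvec s x) a : B x -> R^o) | a < r].

Lemma dual_vecE (T : topologicalType) (B : T -> vectType R) (r : nat)
    (s : lframe B r) (x : T) (a : 'I_r) (v : B x) :
  ((dual_vec s x)`_a : 'Hom(B x, R^o)) v = coord (fvec s x) a v.
Proof.
rewrite /dual_vec -tnth_nth tnth_mktuple.
exact: (lfunE (coord (fvec s x) a : {linear B x -> R^o})).
Qed.

Lemma dual_lfunE (T : topologicalType) (B : T -> vectType R) (r : nat)
    (s : lframe B r) (x : T) (f : 'Hom(B x, R^o)) : fdom s x ->
  f = \sum_(a < r) f (fvec s x)`_a *: ((dual_vec s x)`_a : 'Hom(B x, R^o)).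
Proof.
move=> sx; apply/lfunP => v.
rewrite sum_lfunE {1}(coord_basis (fvec_basis sx) (memvf v)) linear_sum.
apply: eq_bigr => a _; rewrite linearZ scale_lfunE dual_vecE.
exact: mulrC.
Qed.

Lemma dual_vec_basis (T : topologicalType) (B : T -> vectType R) (r : nat)
    (s : lframe B r) (x : T) : fdom s x -> basis_of fullv (dual_vec s x).
Proof.
move=> sx; rewrite basisEdim; apply/andP; split.
  apply/subvP => f _; rewrite [f](dual_lfunE _ sx) memv_suml// => a _.
  by rewrite memvZ// memv_span// mem_nth// size_tuple.
rewrite size_tuple -(size_basis (fvec_basis sx)) !dimvf.
by rewrite {2}/dim /= muln1.
Qed.

Definition dual_frame (T : topologicalType) (B : T -> vectType R) (r : nat)
    (s : lframe B r) : lframe (dual_fibre B) r :=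
  LFrame (fdom_open s) (@dual_vec_basis T B r s).

Variables (m : nat) (M : manifold R m) (r : nat) (E : vbundle M r).

Definition dual_frames : set (lframe (dual_fibre E) r) :=
  [set dual_frame s | s in frames (v := E)].

Lemma dual_frames_cover (x : M) : exists2 s, dual_frames s & fdom s x.
Proof.
have [s fs sx] := frames_cover E x.
by exists (dual_frame s) => //; exists s.
Qed.

Lemma dual_frames_compat s s' : dual_frames s -> dual_frames s' ->
  forall a b : 'I_r, smooth_fun (fdom s `&` fdom s')
    (fun x => coord (fvec s' x) b (fvec s x)`_a).
Proof.
move=> [t ft <-] [t' ft' <-] a b c cc k.
have := frames_compat ft' ft b a cc k.
rewrite (setIC (fdom t')).
apply: eq_Ck; first by apply: cmap_img_open; apply: openI; exact: fdom_open.
move=> _ [x [cx [tx t'x]] <-] /=; rewrite cmapK//.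
rewrite -(dual_vecE t); set f := (dual_vec t x)`_a.
transitivity (coord (dual_vec t' x) b (\sum_(i < r)
    (f : 'Hom(E x, R^o)) (fvec t' x)`_i *: (dual_vec t' x)`_i)).
  have fr := basis_free (dual_vec_basis t'x).
  apply/esym; apply: (coord_sum_free _ _ fr).
by congr coord; apply/esym; exact: dual_lfunE.
Qed.

Definition dual : vbundle M r := VBundle dual_frames_cover dual_frames_compat.

End Dual.

(** * Generalized Lie algebroids *)

(* The bracket acts on (total, set-theoretic) sections, but is only constrained
   on the smooth ones.
   In [gla_leibniz], [h^-1 k] and [eta k] are in general different points of
   [M]; the formula [z^alpha rho^i_alpha (d(f o h)/dx^i o h^-1)] only makes
   sense when both are read in the same coordinates [x^i], hence the quantifier
   over the charts [c] of the given atlas of [M] which contain both; there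
   [z^alpha rho^i_alpha] is the [i]-th component of [rho z]. *)
Record gla (R : realType) (m n : nat) (M N : manifold R m) (F : vbundle N n) :=
  Gla {
  gla_h : diffeo M N ;
  gla_eta : diffeo N M ;
  gla_rho : forall k : N, F k -> tangent (gla_eta k) ;
  gla_bracket : section F -> section F -> section F ;
  gla_rho_linear : forall (k : N) (c : chart R m M) (a : R) (u v : F k),
    atlas c -> cdom c (gla_eta k) ->
    tcomp (gla_rho (a *: u + v)) c =
    a *: tcomp (gla_rho u) c + tcomp (gla_rho v) c ;
  gla_rho_smooth : forall (z : section F) (c : chart R m M) (i : 'I_m),
    smooth_section z -> atlas c ->
    smooth_fun (gla_eta @^-1` cdom c)
      (fun k => tcomp (gla_rho (z k)) c 0 i) ;
  gla_bracket_smooth : forall z w : section F,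
    smooth_section z -> smooth_section w -> smooth_section (gla_bracket z w) ;
  gla_bracket_linear : forall (a : R) (z z' w : section F),
    smooth_section z -> smooth_section z' -> smooth_section w ->
    forall k, gla_bracket (fun k => a *: z k + z' k) w k =
      a *: gla_bracket z w k + gla_bracket z' w k ;
  gla_bracket_anti : forall z w : section F,
    smooth_section z -> smooth_section w ->
    forall k, gla_bracket z w k = - gla_bracket w z k ;
  gla_jacobi : forall z w v : section F,
    smooth_section z -> smooth_section w -> smooth_section v ->
    forall k, gla_bracket z (gla_bracket w v) k +
              gla_bracket w (gla_bracket v z) k +
              gla_bracket v (gla_bracket z w) k = 0 ;
  gla_leibniz : forall (z w : section F) (f : N -> R),
    smooth_section z -> smooth_section w -> smooth_fun setT f ->
    forall (k : N) (c : chart R m M), atlas c ->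
    cdom c (dinv gla_h k) -> cdom c (gla_eta k) ->
    gla_bracket z (fun k => f k *: w k) k =
      f k *: gla_bracket z w k +
      (\sum_(i < m) tcomp (gla_rho (z k)) c 0 i *
         'D_(delta_mx 0 i) (f \o gla_h \o cinv c) (cmap c (dinv gla_h k)))
        *: w k }.

Section GlaLocal.
Context {R : realType} {m n : nat} {M N : manifold R m} {F : vbundle N n}.
Variables (A : gla M F) (c : chart R m M) (t : lframe F n).

Definition rho_comp (a : 'I_n) (i : 'I_m) (k : N) : R :=
  tcomp (gla_rho A (fvec t k)`_a) c 0 i.

(* [t_a], [t_b] are local sections: their bracket at [k] is computed on smooth
   global sections which coincide with them near [k]. *)
Definition structure_functions (C : 'I_n -> 'I_n -> 'I_n -> N -> R) : Prop :=
  forall (a b : 'I_n) (k : N) (z w : section F), fdom t k ->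
    smooth_section z -> smooth_section w ->
    (\forall k' \near k, z k' = (fvec t k')`_a) ->
    (\forall k' \near k, w k' = (fvec t k')`_b) ->
    gla_bracket A z w k = \sum_(g < n) C g a b k *: (fvec t k)`_g.

End GlaLocal.

(** * Local coordinates on the total spaces of [E] and of its dual *)

(* [(x, y)] stands for [y^a s_a] over the point of coordinates [x] (resp.
   [(x, p)] for [p_a s^a]). *)
Definition coords (R : realType) (m r : nat) : normedModType R :=
  ('rV[R]_m * 'rV[R]_r)%type.

Section Coordinates.
Context {R : realType} {m r : nat}.
Local Notation P := (coords R m r).

Definition dx (i : 'I_m) (f : P -> R) : P -> R := 'D_(delta_mx 0 i, 0) f.
Definition dy (a : 'I_r) (f : P -> R) : P -> R := 'D_(0, delta_mx 0 a) f.

(* All the [d^2 f / dy^a dy^b] and [d^2 f / dx^i dy^b] exist and are smooth. *)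
Definition regular_on (U : set P) (f : P -> R) : Prop :=
  forall b : 'I_r, (forall w, U w -> derivable f w (0, delta_mx 0 b)) /\
                   smooth_on U (dy b f).

Definition regular_at (w : P) (f : P -> R) : Prop :=
  exists2 U, open_nbhs w U & regular_on U f.

(* [phi_L] when [f] is [L], [phi_H] when [f] is [H]. *)
Definition legendre_map (f : P -> R) (w : P) : P :=
  (w.1, \row_b \sum_(a < r) w.2 0 a * dy a (dy b f) w).

Variable M : manifold R m.
Implicit Types (B : M -> vectType R) (c : chart R m M).

Definition local_expr B c (s : lframe B r) (f : forall x, B x -> R) : P -> R :=
  fun w => f (cinv c w.1) (\sum_(a < r) w.2 0 a *: (fvec s (cinv c w.1))`_a).

Definition base_dom B c (s : lframe B r) : set 'rV[R]_m :=
  cmap c @` (cdom c `&` fdom s).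

(* Regularity of Lagrange (on [E]) and Hamilton (on the dual) fundamental
   functions. *)
Definition fundamental_function (E : vbundle M r) (L : forall x, E x -> R) :=
  [/\ forall u : section E, smooth_section u ->
        smooth_fun [set x | u x != 0] (fun x => L x (u x)),
      continuous (fun x => L x 0) &
      forall c s, atlas c -> frames (v := E) s ->
        regular_on [set w : P | base_dom c s w.1 /\ w.2 != 0]
          (local_expr c s L)].

Definition legendre_transform (E : vbundle M r) (L : forall x, E x -> R)
    (H : forall x, dual E x -> R) : Prop :=
  fundamental_function H /\
  forall c s, atlas c -> frames (v := E) s ->
  forall w : P, base_dom c s w.1 ->
  exists y : 'rV[R]_r,
    (forall b, w.2 0 b =
       \sum_(a < r) y 0 a * dy a (dy b (local_expr c s L)) (w.1, y)) /\
    local_expr c (dual_frame s) H w =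
      \sum_(a < r) w.2 0 a * y 0 a - local_expr c s L (w.1, y).

End Coordinates.

(** * The Lie algebroids [(rho, eta)TE] and [(rho, eta)TE^*] *)

(* In coordinates the two algebroids have the same expression: a section is
   given by its components [(X^alpha, X~^a)] (resp. [(X^alpha, X~_a)]) in the
   local frame, [rho a i] is [rho^i_a o h o pi] and [C g a b] is
   [L^g_ab o h o pi]. *)
Section Prolongation.
Context {R : realType} {m n r : nat}.
Local Notation P := (coords R m r).
Local Notation sec := (P -> 'rV[R]_n * 'rV[R]_r).
Variables (rho : 'I_n -> 'I_m -> P -> R) (C : 'I_n -> 'I_n -> 'I_n -> P -> R).

Definition frame_h (a : 'I_n) : sec := fun=> (delta_mx 0 a, 0).
Definition frame_v (b : 'I_r) : sec := fun=> (0, delta_mx 0 b).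

Definition anchor (X : sec) (f : P -> R) (w : P) : R :=
  \sum_(a < n) \sum_(i < m) (X w).1 0 a * rho a i w * dx i f w +
  \sum_(b < r) (X w).2 0 b * dy b f w.

(* The bracket with the prescribed values on frames and the Leibniz rule; see
   [bracket_hh], [bracket_hv], [bracket_vv], [bracket_leibniz]. *)
Definition bracket (X Y : sec) : sec := fun w =>
  (\row_g (anchor X (fun w => (Y w).1 0 g) w
           - anchor Y (fun w => (X w).1 0 g) w
           + \sum_(a < n) \sum_(b < n) (X w).1 0 a * (Y w).1 0 b * C g a b w),
   \row_b (anchor X (fun w => (Y w).2 0 b) w
           - anchor Y (fun w => (X w).2 0 b) w)).

Lemma anchor_cst (X : sec) (k : R) (w : P) : anchor X (fun=> k) w = 0.
Proof.
rewrite /anchor big1 ?add0r => [|a _].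
  by rewrite big1 // => b _; rewrite /dy derive_cst mulr0.
by rewrite big1 // => i _; rewrite /dx derive_cst mulr0.
Qed.

Lemma bracket_hh (a b : 'I_n) (w : P) :
  bracket (frame_h a) (frame_h b) w = (\row_g C g a b w, 0).
Proof.
congr pair; apply/rowP => j; rewrite !mxE !anchor_cst subrr ?mxE ?add0r//.
rewrite (bigD1 a)//= [X in _ + X]big1 ?addr0 => [|a' /negPf na].
  rewrite (bigD1 b)//= [X in _ + X]big1 ?addr0 => [|b' /negPf nb].
    by rewrite !mxE !eqxx !mul1r.
  by rewrite !mxE nb andbF mulr0 mul0r.
by rewrite big1// => b' _; rewrite !mxE na andbF !mul0r.
Qed.

Lemma bracket_hv (a : 'I_n) (b : 'I_r) (w : P) :
  bracket (frame_h a) (frame_v b) w = (0, 0).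
Proof.
congr pair; apply/rowP => j; rewrite !mxE !anchor_cst subrr ?mxE ?add0r//.
by rewrite big1// => a' _; rewrite big1// => b' _; rewrite !mxE mulr0 mul0r.
Qed.

Lemma bracket_vv (a b : 'I_r) (w : P) :
  bracket (frame_v a) (frame_v b) w = (0, 0).
Proof.
congr pair; apply/rowP => j; rewrite !mxE !anchor_cst subrr ?mxE ?add0r//.
by rewrite big1// => a' _; rewrite big1// => b' _; rewrite !mxE !mul0r.
Qed.

Lemma anchorM (X : sec) (f g : P -> R) (w : P) :
  (forall v, derivable f w v) -> (forall v, derivable g w v) ->
  anchor X (fun w => f w * g w) w = f w * anchor X g w + g w * anchor X f w.
Proof.
move=> df dg; have D v : 'D_v (fun w => f w * g w) w =
    f w * 'D_v g w + g w * 'D_v f w by exact: deriveM.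
rewrite /anchor /dx /dy !mulrDr !mulr_sumr addrACA -!big_split /=.
congr (_ + _); apply: eq_bigr => a _; last by rewrite D; ring.
by rewrite !mulr_sumr -big_split; apply: eq_bigr => i _ /=; rewrite D; ring.
Qed.

Lemma anchorZ (X : sec) (f g : P -> R) (w : P) :
  anchor (fun w => f w *: X w) g w = f w * anchor X g w.
Proof.
rewrite /anchor mulrDr !mulr_sumr; congr (_ + _); apply: eq_bigr => a _.
  by rewrite mulr_sumr; apply: eq_bigr => i _; rewrite /= !mxE !mulrA.
by rewrite /= !mxE !mulrA.
Qed.

Lemma bracket_leibniz (X Y : sec) (f : P -> R) (w : P) :
  (forall v, derivable f w v) ->
  (forall a v, derivable (fun w => (Y w).1 0 a) w v) ->
  (forall b v, derivable (fun w => (Y w).2 0 b) w v) ->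
  bracket X (fun w => f w *: Y w) w =
  f w *: bracket X Y w + anchor X f w *: Y w.
Proof.
move=> df dY1 dY2.
have E1 j : (fun w => (f w *: Y w).1 0 j) = (fun w => f w * (Y w).1 0 j).
  by apply/funext => w'; rewrite /= mxE.
have E2 j : (fun w => (f w *: Y w).2 0 j) = (fun w => f w * (Y w).2 0 j).
  by apply/funext => w'; rewrite /= mxE.
rewrite [RHS]surjective_pairing /=.
congr pair; apply/rowP => j; rewrite !mxE anchorZ ?E1 ?E2 anchorM//; last ring.
under [X in _ + X = _]eq_bigr => a _.
  under eq_bigr => b _.
    rewrite /= mxE [_ * (f w * _)]mulrCA -mulrA.
  over.
  rewrite -mulr_sumr.
over.
by rewrite -mulr_sumr; ring.
Qed.

Lemma bracket_anti (X Y : sec) (w : P) :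
  (forall g a b w, C g a b w = - C g b a w) ->
  bracket X Y w = - bracket Y X w.
Proof.
move=> CN; rewrite [RHS]surjective_pairing /=.
congr pair; apply/rowP => j; rewrite !mxE; last by rewrite opprB.
suff -> : \sum_(a < n) \sum_(b < n) (X w).1 0 a * (Y w).1 0 b * C j a b w =
    - (\sum_(a < n) \sum_(b < n) (Y w).1 0 a * (X w).1 0 b * C j a b w).
  ring.
rewrite exchange_big -sumrN; apply: eq_bigr => a _; rewrite -sumrN.
by apply: eq_bigr => b _; rewrite CN mulrN [X in X * _]mulrC.
Qed.

Lemma bracketDr (X Y Z : sec) (w : P) :
  (forall a v, derivable (fun w => (Y w).1 0 a) w v) ->
  (forall b v, derivable (fun w => (Y w).2 0 b) w v) ->
  (forall a v, derivable (fun w => (Z w).1 0 a) w v) ->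
  (forall b v, derivable (fun w => (Z w).2 0 b) w v) ->
  bracket X (fun w => Y w + Z w) w = bracket X Y w + bracket X Z w.
Proof.
move=> dY1 dY2 dZ1 dZ2.
have AD (f g : P -> R) : (forall v, derivable f w v) ->
    (forall v, derivable g w v) ->
    anchor X (fun w => f w + g w) w = anchor X f w + anchor X g w.
  move=> df dg; have D v : 'D_v (fun w => f w + g w) w = 'D_v f w + 'D_v g w.
    exact: deriveD.
  rewrite /anchor /dx /dy addrACA -!big_split /=; congr (_ + _).
    apply: eq_bigr => a _; rewrite -big_split; apply: eq_bigr => i _.
    by rewrite D mulrDr.
  by apply: eq_bigr => b _; rewrite D mulrDr.
have aD f : anchor (fun w => Y w + Z w) f w = anchor Y f w + anchor Z f w.
  rewrite /anchor addrACA -!big_split /=; congr (_ + _).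
    apply: eq_bigr => a _; rewrite -big_split; apply: eq_bigr => i _.
    by rewrite mxE !mulrDl.
  by apply: eq_bigr => b _; rewrite mxE mulrDl.
have E1 j : (fun w => (Y w + Z w).1 0 j) = (fun w => (Y w).1 0 j + (Z w).1 0 j).
  by apply/funext => w'; rewrite /= mxE.
have E2 j : (fun w => (Y w + Z w).2 0 j) = (fun w => (Y w).2 0 j + (Z w).2 0 j).
  by apply/funext => w'; rewrite /= mxE.
rewrite [RHS]surjective_pairing /=.
congr pair; apply/rowP => j; rewrite !mxE aD ?E1 ?E2 AD//; last ring.
under [X in _ + X = _]eq_bigr => a _.
  under eq_bigr => b _ do rewrite /= mxE mulrDr mulrDl.
  rewrite big_split /=.
over.
by rewrite big_split /=; ring.
Qed.

End Prolongation.

(** * The morphism [((rho, eta)T phi_L, phi_L)] *)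

Section LegendreMorphism.
Context {R : realType} {m n r : nat}.
Local Notation P := (coords R m r).
Local Notation sec := (P -> 'rV[R]_n * 'rV[R]_r).
Variables (rho : 'I_n -> 'I_m -> P -> R) (C : 'I_n -> 'I_n -> 'I_n -> P -> R).
Variables (L H : P -> R).

Definition tangent_legendre (X : sec) : sec := fun w =>
  let u := legendre_map H w in
  ((X u).1,
   \row_b (\sum_(a < n) \sum_(i < m) rho a i u * (X u).1 0 a * dx i (dy b L) u
           + \sum_(a < r) (X u).2 0 a * dy a (dy b L) u)).

(* The points of [E^*] over the open set [U] of base coordinates where the second derivatives of [H], and those
   of [L] composed with [phi_H], are defined and smooth. It contains the
   points [p != 0] with [phi_H p != 0]; the zero section is not excluded when
   [L] and [H] happen to be regular there. *)
Definition legendre_dom (U : set 'rV[R]_m) : set P :=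
  [set w | [/\ U w.1, regular_at w H & regular_at (legendre_map H w) L]].

(* Preservation of the brackets of smooth sections over the part of [E] above
   [U]; a consequence of the same property over the whole of [E], by locality. *)
Definition lie_algebroid_morphism (U : set 'rV[R]_m) : Prop :=
  forall X Y : sec, smooth_on (fun w : P => U w.1) X ->
    smooth_on (fun w : P => U w.1) Y ->
  forall w, legendre_dom U w ->
    tangent_legendre (bracket rho C X Y) w =
    bracket rho C (tangent_legendre X) (tangent_legendre Y) w.

End LegendreMorphism.

Section LocalData.
Context {R : realType} {m n r : nat} {M N : manifold R m} {F : vbundle N n}.
Variables (A : gla M F) (c : chart R m M) (t : lframe F n).
Local Notation P := (coords R m r).

Definition rho_loc (a : 'I_n) (i : 'I_m) (w : P) : R :=
  rho_comp A c t a i (gla_h A (cinv c w.1)).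

Definition C_loc (C : 'I_n -> 'I_n -> 'I_n -> N -> R) (g a b : 'I_n) (w : P)
  : R := C g a b (gla_h A (cinv c w.1)).

(* The points of the coordinate domain where all the local data are defined. *)
Definition local_dom (B : M -> vectType R) (s : lframe B r) : set 'rV[R]_m :=
  cmap c @` (cdom c `&` fdom s `&`
             [set x | fdom t (gla_h A x) /\ cdom c (gla_eta A (gla_h A x))]).

End LocalData.

(* Main.v *)
Require Import Defs.
From HB Require Import structures.
From mathcomp Require Import all_boot all_order all_algebra.
From mathcomp Require Import all_classical all_reals all_analysis.

Set Implicit Arguments.
Unset Strict Implicit.
Unset Printing Implicit Defensive.

Import Order.TTheory GRing.Theory Num.Theory.
Import numFieldNormedType.Exports.
Local Open Scope classical_set_scope.
Local Open Scope ring_scope.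

(** The four identities are the components of the single equation saying that
    the morphism preserves brackets, evaluated on pairs of frame sections.
    The frame sections are constant in the local frame, hence smooth, so the
    hypothesis applies to them.  Write [T] for the map induced on sections by
    the Legendre morphism.
    - On the source side the bracket of two frame sections is known:
      [[d_alpha, d_beta] = L^gamma_(alpha beta) d_gamma] and every bracket with
      a vertical frame section vanishes.
    - On the target side [T d_alpha] has horizontal part the constant
      [d_alpha] and vertical components [(rho^i_alpha L_ib) o phi_H], while
      [T d'_a] is vertical with components [L_ab o phi_H].  Anchors kill
      constants, so in each bracket only the derivatives of these vertical
      components survive, together with the structure functions on the
      horizontal part.
    The horizontal part of the pair [(d_alpha, d_beta)] gives the first
    identity and its vertical part the second; the pairs [(d_alpha, d'_b)] and
    [(d'_a, d'_b)] give the last two. *)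

Section ConstantMaps.
Context {R : realType} {V W : normedModType R}.

Lemma Ck_cst k (U : set V) (y : W) : Ck k U (fun=> y).
Proof.
elim: k y => [|k IH] y; first by split=> // x _; exact: cst_continuous.
split=> [x _|v]; first exact: cst_continuous.
split=> [x _|]; first exact: derivable_cst.
rewrite [X in Ck k U X](_ : _ = fun=> 0) //.
by apply/funext => x; exact: derive_cst.
Qed.

Lemma smooth_on_cst (U : set V) (y : W) : smooth_on U (fun=> y).
Proof. by move=> k; exact: Ck_cst. Qed.

End ConstantMaps.

Lemma sum_delta_mx (R : pzRingType) (n : nat) (a : 'I_n) (G : 'I_n -> R) :
  \sum_(k < n) (delta_mx 0 a : 'rV[R]_n) 0 k * G k = G a.
Proof.
rewrite (bigD1 a) //= big1 ?addr0 => [|k /negPf nk]; rewrite !mxE ?eqxx.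
  by rewrite mul1r.
by rewrite nk mul0r.
Qed.

Section FrameSections.
Context {R : realType} {m n r : nat}.
Local Notation P := (coords R m r).
Variables (rho : 'I_n -> 'I_m -> P -> R) (C : 'I_n -> 'I_n -> 'I_n -> P -> R).

Lemma anchor_delta_h (a : 'I_n) (y : 'I_r -> P -> R) (f : P -> R) (w : P) :
  anchor rho (fun w => (delta_mx 0 a, \row_b y b w)) f w =
  \sum_(i < m) rho a i w * dx i f w + \sum_(b < r) y b w * dy b f w.
Proof.
rewrite /anchor /=; congr (_ + _); last by apply: eq_bigr => b _; rewrite mxE.
rewrite -[RHS](sum_delta_mx a (fun a => \sum_(i < m) rho a i w * dx i f w)).
apply: eq_bigr => k _; rewrite mulr_sumr.
by apply: eq_bigr => i _; rewrite mulrA.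
Qed.

Lemma anchor_v (y : 'I_r -> P -> R) (f : P -> R) (w : P) :
  anchor rho (fun w => (0, \row_b y b w)) f w =
  \sum_(b < r) y b w * dy b f w.
Proof.
rewrite /anchor /= big1 ?add0r => [|k _].
  by apply: eq_bigr => b _; rewrite mxE.
by rewrite big1 // => i _; rewrite mxE !mul0r.
Qed.

(** Brackets of frame sections have no vertical part, so only the derivative
    terms of the Leibniz rule contribute here. *)
Lemma bracket_row_v (X Y : P -> 'rV[R]_n) (x y : 'I_r -> P -> R)
    (d : 'I_r) (w : P) :
  (bracket rho C (fun w => (X w, \row_b x b w))
                 (fun w => (Y w, \row_b y b w)) w).2 0 d =
  anchor rho (fun w => (X w, \row_b x b w)) (y d) w
  - anchor rho (fun w => (Y w, \row_b y b w)) (x d) w.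
Proof.
have rowE (f : 'I_r -> P -> R) :
    (fun w => (\row_b f b w : 'rV[R]_r) 0 d) = f d.
  by apply/funext => u; rewrite mxE.
by rewrite mxE /= !rowE.
Qed.

(** Constant horizontal components are killed by the anchors, so the horizontal
    part of the bracket is the one of the frame sections themselves. *)
Lemma bracket_delta_h (a b : 'I_n) (Y Z : P -> 'rV[R]_r) (g : 'I_n) (w : P) :
  (bracket rho C (fun w => (delta_mx 0 a, Y w))
                 (fun w => (delta_mx 0 b, Z w)) w).1 0 g = C g a b w.
Proof.
rewrite mxE !anchor_cst subrr add0r /=.
rewrite -(sum_delta_mx a (fun k => C g k b w)); apply: eq_bigr => k _.
rewrite -(sum_delta_mx b (fun l => C g k l w)) mulr_sumr.
by apply: eq_bigr => l _; rewrite mulrA.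
Qed.

Variables (L H : P -> R).
Local Notation phiH := (legendre_map H).
Local Notation TL := (tangent_legendre rho L H).
Local Notation Lyy a b := (dy a (dy b L)).
Local Notation rhoL a b :=
  ((fun w => \sum_(i < m) rho a i w * dx i (dy b L) w) \o phiH).

Lemma tangent_legendre_frame_h (a : 'I_n) :
  TL (frame_h a) = fun w => (delta_mx 0 a, \row_b rhoL a b w).
Proof.
apply/funext => w; congr pair; apply/rowP => b; rewrite !mxE /=.
rewrite [X in _ + X]big1 ?addr0 => [|k _]; last by rewrite mxE mul0r.
set u := phiH w.
rewrite -(sum_delta_mx a (fun k => \sum_i rho k i u * dx i (dy b L) u)).
apply: eq_bigr => k _; rewrite mulr_sumr.
by apply: eq_bigr => i _; rewrite [rho k i u * _]mulrC mulrA.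
Qed.

Lemma tangent_legendre_frame_v (a : 'I_r) :
  TL (frame_v a) = fun w => (0, \row_b (Lyy a b \o phiH) w).
Proof.
apply/funext => w; congr pair; apply/rowP => b; rewrite !mxE /=.
rewrite big1 ?add0r => [|k _]; last first.
  by rewrite big1 // => i _; rewrite mxE mulr0 mul0r.
exact: (sum_delta_mx a (fun k => Lyy k b (phiH w))).
Qed.

Lemma tangent_legendre0 (w : P) : TL (fun=> (0, 0)) w = (0, 0).
Proof.
congr pair; apply/rowP => b; rewrite !mxE /= !big1 ?addr0 // => k _.
  by rewrite mxE mul0r.
by rewrite big1 // => i _; rewrite mxE mulr0 mul0r.
Qed.

(** One equation between sections carries two identities: the vertical part of
    the left-hand side is linear in the structure functions, because the
    bracket of the sources is [L^gamma_(a b) d_gamma]. *)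
Lemma bracket_tangent_legendre_hh (a b : 'I_n) (w : P) :
  TL (bracket rho C (frame_h a) (frame_h b)) w =
    bracket rho C (TL (frame_h a)) (TL (frame_h b)) w ->
  (forall g, (C g a b \o phiH) w = C g a b w) /\
  forall d, \sum_(g < n) \sum_(k < m)
      C g a b (phiH w) * rho g k (phiH w) * dx k (dy d L) (phiH w) =
    \sum_(i < m) rho a i w * dx i (rhoL b d) w
    - \sum_(j < m) rho b j w * dx j (rhoL a d) w
    + \sum_(e < r) rhoL a e w * dy e (rhoL b d) w
    - \sum_(e < r) rhoL b e w * dy e (rhoL a d) w.
Proof.
rewrite !tangent_legendre_frame_h.
rewrite (_ : bracket _ _ (frame_h a) _ = fun w => (\row_g C g a b w, 0));
  last by apply/funext => u; exact: bracket_hh.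
move=> E; split=> [g|d].
  have := congr1 (fun p : 'rV[R]_n * 'rV[R]_r => p.1 0 g) E.
  by rewrite bracket_delta_h mxE.
have := congr1 (fun p : 'rV[R]_n * 'rV[R]_r => p.2 0 d) E.
rewrite (bracket_row_v (fun=> _) (fun=> _)) !anchor_delta_h mxE /=.
rewrite [X in _ + X = _ -> _]big1 ?addr0 => [|k _]; last by rewrite mxE mul0r.
move=> {}E; transitivity (\sum_(g < n) \sum_(k < m)
    rho g k (phiH w) * (\row_g C g a b (phiH w) : 'rV[R]_n) 0 g
    * dx k (dy d L) (phiH w)).
  apply: eq_bigr => g _; apply: eq_bigr => k _.
  by rewrite mxE [rho _ _ _ * _]mulrC.
by rewrite E opprD addrACA !addrA.
Qed.

Lemma bracket_tangent_legendre_hv (a : 'I_n) (b d : 'I_r) (w : P) :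
  TL (bracket rho C (frame_h a) (frame_v b)) w =
    bracket rho C (TL (frame_h a)) (TL (frame_v b)) w ->
  0 = \sum_(i < m) rho a i w * dx i (Lyy b d \o phiH) w
      + \sum_(e < r) rhoL a e w * dy e (Lyy b d \o phiH) w
      - \sum_(e < r) (Lyy b e \o phiH) w * dy e (rhoL a d) w.
Proof.
rewrite tangent_legendre_frame_h tangent_legendre_frame_v.
rewrite (_ : bracket _ _ (frame_h a) _ = fun=> (0, 0));
  last by apply/funext => u; exact: bracket_hv.
rewrite tangent_legendre0 => /(congr1 (fun p : 'rV[R]_n * 'rV[R]_r => p.2 0 d)).
rewrite (bracket_row_v (fun=> _) (fun=> _)).
by rewrite anchor_delta_h anchor_v mxE.
Qed.

Lemma bracket_tangent_legendre_vv (a b d : 'I_r) (w : P) :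
  TL (bracket rho C (frame_v a) (frame_v b)) w =
    bracket rho C (TL (frame_v a)) (TL (frame_v b)) w ->
  0 = \sum_(e < r) (Lyy a e \o phiH) w * dy e (Lyy b d \o phiH) w
      - \sum_(e < r) (Lyy b e \o phiH) w * dy e (Lyy a d \o phiH) w.
Proof.
rewrite !tangent_legendre_frame_v.
rewrite (_ : bracket _ _ (frame_v a) _ = fun=> (0, 0));
  last by apply/funext => u; exact: bracket_vv.
rewrite tangent_legendre0 => /(congr1 (fun p : 'rV[R]_n * 'rV[R]_r => p.2 0 d)).
rewrite (bracket_row_v (fun=> _) (fun=> _)) mxE => E.
by apply: (etrans E); congr (_ - _); exact: anchor_v.
Qed.

End FrameSections.

Theorem theorem54 (R : realType) (m n r : nat) (M N : manifold R m)
    (F : vbundle N n) (A : gla M F)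
    (E : vbundle M r) (L : forall x : M, E x -> R)
    (hL : fundamental_function L)
    (H : forall x : M, dual E x -> R) (hH : legendre_transform L H)
    (c : chart R m M) (hc : atlas c)
    (s : lframe E r) (hs : frames s)
    (t : lframe F n) (ht : frames t)
    (C : 'I_n -> 'I_n -> 'I_n -> N -> R) (hC : structure_functions A t C) :
  let Lc : coords R m r -> R := local_expr c s L in
  let Hc : coords R m r -> R := local_expr c (dual_frame s) H in
  let rho : 'I_n -> 'I_m -> coords R m r -> R := rho_loc A c t in
  let Lst : 'I_n -> 'I_n -> 'I_n -> coords R m r -> R := C_loc A c C in
  let U : set 'rV[R]_m := local_dom A c t s in
  let phiH : coords R m r -> coords R m r := legendre_map Hc in
  let Lyy (a b : 'I_r) : coords R m r -> R := dy a (dy b Lc) in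
  let Lxy (i : 'I_m) (b : 'I_r) : coords R m r -> R := dx i (dy b Lc) in
  let rhoL (a : 'I_n) (b : 'I_r) : coords R m r -> R :=
    (fun w => \sum_(i < m) rho a i w * Lxy i b w) \o phiH in
  lie_algebroid_morphism rho Lst Lc Hc U ->
  forall w : coords R m r, legendre_dom Lc Hc U w ->
  [/\ forall alpha beta gamma : 'I_n,
        (Lst gamma alpha beta \o phiH) w = Lst gamma alpha beta w,
      forall (alpha beta : 'I_n) (b : 'I_r),
        ((fun u => \sum_(gamma < n) \sum_(k < m)
            Lst gamma alpha beta u * rho gamma k u * Lxy k b u) \o phiH) w =
        \sum_(i < m) rho alpha i w * dx i (rhoL beta b) w
        - \sum_(j < m) rho beta j w * dx j (rhoL alpha b) w
        + \sum_(a < r) rhoL alpha a w * dy a (rhoL beta b) w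
        - \sum_(a < r) rhoL beta a w * dy a (rhoL alpha b) w,
      forall (alpha : 'I_n) (a b : 'I_r),
        0 = \sum_(i < m) rho alpha i w * dx i (Lyy b a \o phiH) w
            + \sum_(e < r) rhoL alpha e w * dy e (Lyy b a \o phiH) w
            - \sum_(e < r) (Lyy b e \o phiH) w * dy e (rhoL alpha a) w &
      forall a b d : 'I_r,
        0 = \sum_(e < r) (Lyy a e \o phiH) w * dy e (Lyy b d \o phiH) w
            - \sum_(e < r) (Lyy b e \o phiH) w * dy e (Lyy a d \o phiH) w].
Proof.
move=> Lc Hc rho Lst U phiH Lyy Lxy rhoL morph w domw.
have frames_preserved X Y := morph (fun=> X) (fun=> Y)
  (smooth_on_cst _ X) (smooth_on_cst _ Y) w domw.
split=> [alpha beta gamma|alpha beta b|alpha a b|a b d].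
- exact: (bracket_tangent_legendre_hh (frames_preserved _ _)).1.
- exact: (bracket_tangent_legendre_hh (frames_preserved _ _)).2.
- exact: (bracket_tangent_legendre_hv a (frames_preserved _ _)).
- exact: (bracket_tangent_legendre_vv d (frames_preserved _ _)).
Qed.
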